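(* Let $G$ be a digraph and $A,B\subseteq V(G)$. There is a domination linkage from $A$ to $B$ if and only if every finite subset of $A$ can be linked to $B$.
   Context: Paths are finite directed paths; ''disjoint'' means edge-disjoint. A directed ray $R$ dominates $B$ if there are infinitely many edge-disjoint directed paths from vertices of $R$ to $B$; a vertex $v$ dominates $B$ if there are infinitely many edge-disjoint directed paths from $v$ to $B$; a path dominates $B$ if its last vertex dominates $B$. A domination linkage from $A$ to $B$ is a family $(Q_a\mid a\in A)$ of pairwise edge-disjoint directed paths or rays with $Q_a$ starting at $a$ and either ending in $B$ or dominating $B$. A finite set $S$ can be linked to $B$ if there are pairwise edge-disjoint directed paths $(P_s\mid s\in S)$ with $P_s$ from $s$ to $B$. *)

(* Defs.v *)
From Stdlib Require List.
From mathcomp Require Import all_boot all_classical.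

Set Implicit Arguments.
Unset Strict Implicit.
Unset Printing Implicit Defensive.

Local Open Scope classical_set_scope.

(* Vertex and edge types are arbitrary, so digraphs may be infinite; loops and
   parallel edges are allowed.  The simple digraphs are those in which
   [init] is never equal to [ter] and the pair [(init, ter)] is injective. *)
Record digraph := Digraph {
  vertex : Type;
  edge : Type;
  init : edge -> vertex;
  ter : edge -> vertex
}.

Section Paths.
Variable G : digraph.

Fixpoint is_walk (x : vertex G) (p : seq (edge G)) : Prop :=
  if p is e :: p' then init e = x /\ is_walk (ter e) p' else True.

(* Since [vertex G] carries no decidable equality, distinctness of the vertices
   is expressed with [List.NoDup].  The empty list of edges gives the trivial
   path at [path_start]. *)
Record dpath := DPath {
  path_start : vertex G;
  path_edges : seq (edge G);
  path_is_walk : is_walk path_start path_edges;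
  path_nodup : List.NoDup (path_start :: map (@ter G) path_edges)
}.

Definition path_end (p : dpath) : vertex G :=
  last (path_start p) (map (@ter G) (path_edges p)).

Definition path_edge_set (p : dpath) : set (edge G) :=
  [set e | List.In e (path_edges p)].

(* A ray is determined by its edges; its vertices are their initial vertices. *)
Record dray := DRay {
  ray_edge : nat -> edge G;
  ray_is_walk : forall n, ter (ray_edge n) = init (ray_edge n.+1);
  ray_nodup : injective (fun n => init (ray_edge n))
}.

Definition ray_start (r : dray) : vertex G := init (ray_edge r 0).

Definition ray_vertex_set (r : dray) : set (vertex G) :=
  range (fun n => init (ray_edge r n)).

Definition ray_edge_set (r : dray) : set (edge G) := range (ray_edge r).

(* [P] is a set of paths rather than an indexed family: a trivial path, although
   edge-disjoint from itself, is counted only once. *)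
Definition inf_edge_disjoint_paths (X B : set (vertex G)) : Prop :=
  exists P : set dpath,
    [/\ infinite_set P,
        trivIset P path_edge_set &
        forall p, P p -> X (path_start p) /\ B (path_end p)].

Definition vertex_dominates (v : vertex G) (B : set (vertex G)) : Prop :=
  inf_edge_disjoint_paths [set v] B.

Definition path_dominates (p : dpath) (B : set (vertex G)) : Prop :=
  vertex_dominates (path_end p) B.

Definition ray_dominates (r : dray) (B : set (vertex G)) : Prop :=
  inf_edge_disjoint_paths (ray_vertex_set r) B.

Definition path_or_ray : Type := (dpath + dray)%type.

Definition pr_start (q : path_or_ray) : vertex G :=
  match q with inl p => path_start p | inr r => ray_start r end.

Definition pr_edge_set (q : path_or_ray) : set (edge G) :=
  match q with inl p => path_edge_set p | inr r => ray_edge_set r end.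

Definition ends_in_or_dominates (q : path_or_ray) (B : set (vertex G)) : Prop :=
  match q with
  | inl p => B (path_end p) \/ path_dominates p B
  | inr r => ray_dominates r B
  end.

(* Families indexed by a set of vertices are total functions, of which only the
   values on that set matter. *)
Definition domination_linkage (A B : set (vertex G))
    (Q : vertex G -> path_or_ray) : Prop :=
  (forall a, A a -> pr_start (Q a) = a /\ ends_in_or_dominates (Q a) B) /\
  trivIset A (fun a => pr_edge_set (Q a)).

Definition can_be_linked (S B : set (vertex G)) : Prop :=
  exists P : vertex G -> dpath,
    (forall s, S s -> path_start (P s) = s /\ B (path_end (P s))) /\
    trivIset S (fun s => path_edge_set (P s)).

End Paths.

(* Main.v *)
Require Import Defs.
From HB Require Import structures.
From mathcomp Require Import all_boot all_classical finmap zify.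

Set Implicit Arguments.
Unset Strict Implicit.
Unset Printing Implicit Defensive.

Local Open Scope classical_set_scope.

(* Call a set of vertices a finite cut if it is disjoint from B and has finitely
   many outgoing edges.  By an augmenting path argument a finite set S is linked
   to B iff every finite cut X satisfies |S & X| <= d(X), where d(X) counts the
   edges leaving X, and a domination linkage satisfies this Hall condition as
   well, since each member starting in X has to leave X.

   Conversely, Zorn's lemma gives a maximal partial domination linkage M such that
   the vertices of A not yet linked satisfy the Hall condition for the finite
   cuts X of G, with d(X) counting the edges unused by M only; as the cuts are
   finite, this passes to unions of chains.  Moreover M uses only finitely many
   edges starting in X, each of its members having to leave X through one of its
   finitely many outgoing edges.

   To extend M at a, move a token from a, keeping the Hall condition with the token
   counted as an additional unlinked vertex.  From inside a finite cut Y the token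
   can be moved out of Y: in a superset of Y of least excess a flow exists, and by
   submodularity following it harms no finite cut.  Leaving successively larger
   finite cuts of minimal, then inclusion-maximal, out-degree, the token either
   reaches a vertex in no finite cut, which is in B or dominates B, or traces an
   infinite trail finally outside every finite cut; then the last visits of the
   trail to its vertices form a ray that dominates B. *)

HB.instance Definition _ (G : digraph) := gen_eqMixin (vertex G).
HB.instance Definition _ (G : digraph) := gen_choiceMixin (vertex G).
HB.instance Definition _ (G : digraph) := gen_eqMixin (edge G).
HB.instance Definition _ (G : digraph) := gen_choiceMixin (edge G).

(* Meaningful for finite sets only: an infinite set has [ncard] 0. *)
Definition ncard (T : choiceType) (P : set T) : nat := #|` fset_set P|.

(** * Cardinalities of finite sets *)

Section Ncard.
Variable T : choiceType.
Implicit Types (P Q : set T) (s : seq T).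

Lemma ncard0 : ncard (set0 : set T) = 0.
Proof. by rewrite /ncard fset_set0 cardfs0. Qed.

(** Since |P| + |Q| = |P U Q| + |P & Q|, it is enough to compare unions and intersections;
    submodularity is read off in this form. *)
Lemma ncard_leD P1 P2 P3 P4 : finite_set P3 -> finite_set P4 ->
  P1 `|` P2 `<=` P3 `|` P4 -> P1 `&` P2 `<=` P3 `&` P4 ->
  ncard P1 + ncard P2 <= ncard P3 + ncard P4.
Proof.
move=> f3 f4 hU hI.
have f34 : finite_set (P3 `|` P4) by rewrite finite_setU.
have [f1 f2] : finite_set P1 /\ finite_set P2.
  by split; apply: sub_finite_set f34; apply: subset_trans hU => x; [left|right].
rewrite /ncard -cardfsUI -[leqRHS]cardfsUI -!fset_setU // -!fset_setI //.
apply: leq_add; apply: fsubset_leq_card; rewrite -fset_set_sub //.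
- by rewrite finite_setU.
- exact: finite_setIl.
- exact: finite_setIl.
Qed.

Lemma ncard_le P Q : finite_set Q -> P `<=` Q -> ncard P <= ncard Q.
Proof.
move=> fQ sPQ; have := @ncard_leD P set0 Q set0 fQ (finite_set0 _).
rewrite !setU0 !setI0 ncard0 !addn0; exact.
Qed.

Lemma size_le_ncard P s : finite_set P -> uniq s ->
  (forall x, x \in s -> P x) -> size s <= ncard P.
Proof.
move=> fP us sP; apply: uniq_leq_size => // x /sP Px.
by rewrite in_fset_set //; apply/mem_set.
Qed.

Lemma ncard_enum P : finite_set P ->
  exists s, [/\ uniq s, forall x, (x \in s) <-> P x & size s = ncard P].
Proof.
move=> fP; exists (enum_fset (fset_set P)); split => // x.
have -> : (x \in enum_fset (fset_set P)) = (x \in P) by exact: in_fset_set.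
by split=> [/set_mem|/mem_set].
Qed.

Lemma ncard_le_sizes P k :
  (forall s, uniq s -> (forall x, x \in s -> P x) -> size s <= k) ->
  finite_set P /\ ncard P <= k.
Proof.
move=> h; have fP : finite_set P.
  apply: contrapT => /(infinite_set_fset k.+1)[F FP].
  rewrite leqNgt ltnS h //.
by split=> //; have [s [us sP <-]] := ncard_enum fP; apply: h => // x /sP.
Qed.

Lemma ncard_set1 (x : T) : ncard [set x] = 1.
Proof. by rewrite /ncard fset_set1 cardfs1. Qed.

Lemma count_uniq_ncard s P : uniq s ->
  ncard [set x | P x /\ x \in s] = count (fun x => `[< P x >]) s.
Proof.
move=> us; rewrite -size_filter; set t := [seq _ <- _ | _].
have tP x : (P x /\ x \in s) <-> x \in t.
  by rewrite mem_filter; split=> [[/asboolT -> ->]|/andP[/asboolP]].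
have ft : finite_set [set x | P x /\ x \in s].
  by apply/finite_seqP; exists t; apply/seteqP; split=> x; have [] := tP x.
apply/eqP; rewrite eqn_leq; apply/andP; split.
  have [u [uu uP <-]] := ncard_enum ft.
  by apply: uniq_leq_size => // x /uP /tP.
by apply: size_le_ncard; rewrite ?filter_uniq // => x /tP.
Qed.

End Ncard.

(** Among finitely many members of a chain, one contains the others. Both uses of Zorn's lemma rest
    on this. *)
Lemma chain_common (T : Type) (I : eqType) (C : set (set T)) (Q : I -> set T -> Prop)
    (s : seq I) :
  C !=set0 -> total_on C subset ->
  (forall i X Y, X `<=` Y -> Q i X -> Q i Y) ->
  (forall i, i \in s -> exists2 X, C X & Q i X) ->
  exists2 X, C X & forall i, i \in s -> Q i X.
Proof.
move=> [X0 CX0] totC monoQ; elim: s => [|i s IHs] Qs; first by exists X0.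
have [X CX QX] : exists2 X, C X & forall j, j \in s -> Q j X.
  by apply: IHs => j js; apply: Qs; rewrite inE js orbT.
have [Y CY QY] := Qs i (mem_head _ _).
have [XY|YX] := totC _ _ CX CY.
  by exists Y => // j; rewrite inE => /orP[/eqP-> //|/QX]; apply: monoQ.
by exists X => // j; rewrite inE => /orP[/eqP->|/QX //]; apply: monoQ QY.
Qed.

(** * Finite cuts and submodularity *)

Section Cuts.
Variable G : digraph.
Implicit Types (H : set (edge G)) (X Y B : set (vertex G)).

Definition out H X : set (edge G) :=
  [set e | [/\ H e, X (init e) & ~ X (ter e)]].

Definition finite_cut B X : Prop :=
  finite_set (out setT X) /\ forall v, X v -> ~ B v.

Lemma out_sub H H' X : H `<=` H' -> out H X `<=` out H' X.
Proof. by move=> sH e [/sH]. Qed.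

Lemma finite_out H B X : finite_cut B X -> finite_set (out H X).
Proof. by case=> fX _; apply: sub_finite_set fX; apply: out_sub. Qed.

Lemma out_submodular H X Y :
  finite_set (out H X) -> finite_set (out H Y) ->
  ncard (out H (X `&` Y)) + ncard (out H (X `|` Y)) <=
  ncard (out H X) + ncard (out H Y).
Proof.
move=> fX fY; apply: ncard_leD => // e.
- case=> -[He].
    by move=> [Xe Ye] /not_andP[nX|nY]; [left|right].
  by move=> XYe /not_orP[nX nY]; case: XYe => ?; [left|right].
- by case=> -[He [Xe Ye] _] [_ _ /not_orP[nX nY]].
Qed.

Lemma finite_cutU B X Y :
  finite_cut B X -> finite_cut B Y -> finite_cut B (X `|` Y).
Proof.
move=> [fX XB] [fY YB]; split; last by move=> v [/XB|/YB].
apply: (@sub_finite_set _ _ (out setT X `|` out setT Y)).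
  by move=> e [_ XYe /not_orP[nX nY]]; case: XYe => ?; [left|right].
by rewrite finite_setU.
Qed.

Lemma finite_cutI B X Y :
  finite_cut B X -> finite_cut B Y -> finite_cut B (X `&` Y).
Proof.
move=> [fX XB] [fY YB]; split; last by move=> v [/XB].
apply: (@sub_finite_set _ _ (out setT X `|` out setT Y)).
  by move=> e [_ [Xe Ye] /not_andP[nX|nY]]; [left|right].
by rewrite finite_setU.
Qed.

Lemma out_finite_diff H X Y : X `<=` Y ->
  finite_set [set e | Y (init e) /\ ~ H e] -> finite_set (out H X) ->
  finite_set (out setT X).
Proof.
move=> XY fY fX.
apply: (@sub_finite_set _ _ (out H X `|` [set e | Y (init e) /\ ~ H e])).
  move=> e [_ Xe nXe]; case: (pselect (H e)) => He; first by left.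
  by right; split=> //; apply: XY.
by rewrite finite_setU.
Qed.

End Cuts.

(** * Unit-capacity flows and augmenting paths *)

Section Flow.
Variable G : digraph.
Implicit Types (H : set (edge G)) (X Y B : set (vertex G)).
Implicit Types (F : seq (edge G)) (L : seq (vertex G)).

Definition outdeg F X : nat :=
  count (fun e => `[< X (init e) /\ ~ X (ter e) >]) F.

Definition indeg F X : nat :=
  count (fun e => `[< ~ X (init e) /\ X (ter e) >]) F.

Definition tokens L X : nat := count (fun v => `[< X v >]) L.

(** Tokens are the sources, vertices outside [Y] the sinks. Conservation is imposed on all subsets
    of [Y], infinite ones included, which spares summing over vertices. *)
Definition flow Y F L : Prop :=
  forall X, X `<=` Y -> outdeg F X = indeg F X + tokens L X.

(** Adding [e] to a flow, or deleting it, shifts a surplus between [init e] and [ter e]. *)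
Lemma edge_balance (e : edge G) X :
  `[< X (init e) /\ ~ X (ter e) >] + `[< X (ter e) >] =
  `[< ~ X (init e) /\ X (ter e) >] + `[< X (init e) >] :> nat.
Proof.
by rewrite !asbool_and !asbool_neg; case: `[< X (init e) >]; case: `[< _ >].
Qed.

Definition resid H F (u w : vertex G) : bool :=
  `[< (exists e, [/\ H e, e \notin F, init e = u & ter e = w]) \/
      (exists2 e, e \in F & init e = w /\ ter e = u) >].

Lemma outdeg_rem F X e : e \in F ->
  outdeg F X = `[< X (init e) /\ ~ X (ter e) >] + outdeg (rem e F) X.
Proof. by move=> eF; rewrite /outdeg (permP (perm_to_rem eF)). Qed.

Lemma indeg_rem F X e : e \in F ->
  indeg F X = `[< ~ X (init e) /\ X (ter e) >] + indeg (rem e F) X.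
Proof. by move=> eF; rewrite /indeg (permP (perm_to_rem eF)). Qed.

(* [F] is a flow except that one of the tokens in [L] has only been sent as far
   as [v]; pushing it along a residual path out of [Y] completes the flow. *)
Lemma augment H Y L p v F :
  uniq F -> (forall e, e \in F -> H e /\ Y (init e)) ->
  (forall X, X `<=` Y ->
     outdeg F X + `[< X v >] = indeg F X + tokens L X) ->
  path (resid H F) v p -> uniq (v :: p) -> ~ Y (last v p) ->
  exists F', [/\ uniq F', forall e, e \in F' -> H e /\ Y (init e) &
    flow Y F' L].
Proof.
elim: p v F => [|w p IHp] v F uF FH FL.
  move=> _ _ /= nYv; exists F; split=> // X XY.
  by rewrite -FL // (asboolF (contra_not (XY v) nYv)) addn0.
case: (pselect (Y v)) => [Yv|nYv _ _ _]; last first.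
  exists F; split=> // X XY.
  by rewrite -FL // (asboolF (contra_not (XY v) nYv)) addn0.
rewrite [path _ _ _]/= [uniq _]/= [last _ _]/=.
move=> /andP[res pp] /andP[vp /andP[wp up]] nYl.
(* The rest of the path avoids [v], so its residual arcs survive a change of [F] at an edge incident
   with [v]. *)
have resE F' : (forall e, init e != v -> ter e != v -> (e \in F') = (e \in F)) ->
    path (resid H F') w p.
  move=> FF'.
  apply: (sub_in_path (P := [pred x | x != v])) pp; last first.
    by apply/allP => x xp /=; apply: contraNneq vp => <-.
  move=> x y /= xv yv; rewrite !inE in xv yv; move=> /asboolP xy; apply/asboolP.
  case: xy => [[e [He eF ex ey]]|[e eF [ey ex]]].
    by left; exists e; split=> //; rewrite FF' ?ex ?ey.
  by right; exists e => //; rewrite FF' ?ex ?ey.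
move/asboolP: res => [[e [He eF ev ew]]|[e eF [ew ev]]].
  apply: (IHp w (e :: F)); rewrite /= ?eF ?wp //.
  - by move=> f; rewrite inE => /orP[/eqP->|/FH //]; rewrite ev.
  - move=> X XY; have := FL X XY; have := edge_balance e X.
    rewrite /outdeg /indeg /= ev ew.
  do 4!move: (nat_of_bool _) => ?; lia.
  - apply: resE => f fv _; rewrite inE.
    by case: eqP => // fe; rewrite fe ev eqxx in fv.
apply: (IHp w (rem e F)); rewrite /= ?rem_uniq ?wp //.
- by move=> f /mem_rem /FH.
- move=> X XY; have := FL X XY; have := edge_balance e X.
  rewrite (outdeg_rem _ eF) (indeg_rem _ eF) ev ew.
  do 4!move: (nat_of_bool _) => ?; lia.
- apply: resE => f _ fv; rewrite mem_rem_uniq // inE.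
  by case: eqP => // fe; rewrite fe ev eqxx in fv.
Qed.

(** Tokens are added one by one. If the set [R] of vertices reachable from [s] in the residual graph
    lay inside [Y], all edges of [H] leaving it would be in [F] and no edge of [F] would enter it;
    [R] would be a finite cut with only [tokens L R] outgoing edges in [H], one too few for
    [s :: L]. Otherwise a residual path leaves [Y], and the flow is augmented along it. *)
Lemma flow_exists B H Y L :
  (forall v, Y v -> ~ B v) -> finite_set [set e | Y (init e) /\ ~ H e] ->
  (forall X, finite_cut B X -> X `<=` Y -> tokens L X <= ncard (out H X)) ->
  exists F, [/\ uniq F, forall e, e \in F -> H e /\ Y (init e) & flow Y F L].
Proof.
move=> YB fH; elim: L => [|s L IHL] hall; first by exists [::].
have [|F [uF FH FL]] := IHL.
  by move=> X cX XY; apply: leq_trans (hall X cX XY); rewrite leq_addl.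
pose R := [set v | exists2 p, path (resid H F) s p & last s p = v].
case: (pselect (R `<=` Y)) => [RY|/existsNP[v /not_implyP[[p pp <-] nYv]]].
  have outF e : out H R e -> e \in F.
    move=> [He [p pp ep] nR]; apply: contrapT => /negP eF; apply: nR.
    exists (rcons p (ter e)); last by rewrite last_rcons.
    by rewrite rcons_path pp ep; apply/asboolP; left; exists e.
  have inF0 : indeg F R = 0.
    apply/eqP; rewrite -leqn0 leqNgt -has_count; apply/hasPn => e eF.
    apply/negP => /asboolP[nRi [p pp ep]]; apply: nRi.
    exists (rcons p (init e)); last by rewrite last_rcons.
    by rewrite rcons_path pp ep; apply/asboolP; right; exists e.
  have fR : finite_set (out H R) by apply: sub_finite_set (finite_seq F).
  have cR : finite_cut B R.
    by split; [apply: out_finite_diff RY fH fR | move=> v /RY /YB].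
  have := hall R cR RY.
  have -> : out H R = [set e | (R (init e) /\ ~ R (ter e)) /\ e \in F].
    apply/seteqP; split=> e; first by move=> oe; split; [case: oe|apply: outF].
    by move=> [[Ri Rt] /FH[]].
  rewrite (@count_uniq_ncard _ F (fun e => R (init e) /\ ~ R (ter e))) //.
  rewrite -/(outdeg F R) FL // inF0 /= asboolT; last by exists [::].
  by rewrite ltnn.
move: nYv; case/shortenP: pp => q pq uq _ nYq.
by apply: (@augment H Y (s :: L) q s F) => // X XY; rewrite FL //= addnCA addnC.
Qed.

(** While the token is inside [Y], conservation at [[set v]] provides an edge of [F] out of [v];
    deleting it leaves a flow for the token at the next vertex. As [F] is finite, the token gets out
    of [Y]. *)
Lemma flow_walk Y L F v : (forall e, e \in F -> Y (init e)) ->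
  flow Y F (v :: L) ->
  exists r F', [/\ is_walk v r, perm_eq F (r ++ F'),
    ~ Y (last v (map (@ter G) r)) & flow Y F' L].
Proof.
have [n] := ubnP (size F); elim: n F v => // n IHn F v ltFn FY FL.
case: (pselect (Y v)) => Yv; last first.
  exists [::], F; split=> // X XY.
  by rewrite FL //= (asboolF (contra_not (XY v) Yv)).
have vY : [set v] `<=` Y by move=> _ ->.
have : 0 < outdeg F [set v] by rewrite FL //= asboolT // addnCA.
rewrite -has_count => /hasP[e eF /asboolP[/= ev _]].
have [|f /mem_rem /FY //||r [F' [wr pF' nYr FL']]] := IHn (rem e F) (ter e).
- by rewrite size_rem //; case: (F) eF ltFn.
- move=> X XY; have := FL X XY; have := edge_balance e X.
  rewrite (outdeg_rem _ eF) (indeg_rem _ eF) ev /=.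
  do 4!move: (nat_of_bool _) => ?; lia.
exists (e :: r), F'; split=> //.
by rewrite (perm_trans (perm_to_rem eF)) // perm_cons.
Qed.

End Flow.

(** * Walks, domination and the Hall condition *)

Section Walks.
Variable G : digraph.
Implicit Types (H : set (edge G)) (X Y B U S : set (vertex G)).

Definition walk_end (x : vertex G) (p : seq (edge G)) : vertex G :=
  last x (map (@ter G) p).

Lemma walk_end_cat x p q : walk_end x (p ++ q) = walk_end (walk_end x p) q.
Proof. by rewrite /walk_end map_cat last_cat. Qed.

Lemma is_walk_cat x p q :
  is_walk x (p ++ q) <-> is_walk x p /\ is_walk (walk_end x p) q.
Proof.
elim: p x => [|e p IHp] x /=; first by split=> [|[]].
by rewrite IHp; split=> [[? []]|[[]]].
Qed.

Lemma InP (T : eqType) (s : seq T) x : List.In x s <-> x \in s.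
Proof.
elim: s => //= y s IHs; rewrite inE IHs eq_sym.
by split=> [[->|->]|/orP[/eqP|]]; rewrite ?eqxx ?orbT //; [left|right].
Qed.

Lemma NoDupP (T : eqType) (s : seq T) : List.NoDup s <-> uniq s.
Proof.
elim: s => [|x s IHs] /=; first by split=> // _; constructor.
rewrite List.NoDup_cons_iff IHs (InP s x); split=> [[/negP-> ->]//|].
by case/andP=> /negP.
Qed.

Lemma walk_dpath x p : is_walk x p ->
  exists q : dpath G, [/\ path_start q = x, path_end q = walk_end x p &
    forall e, e \in path_edges q -> e \in p].
Proof.
elim: p x => [|e p IHp] x /=.
  move=> _; have nd : List.NoDup (x :: map (@ter G) [::]) by apply/NoDupP.
  by exists (@DPath _ x [::] I nd).
move=> [ex /IHp[[y q wq ndq] /= [yE qE sq]]].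
have {}qE : walk_end y q = walk_end (ter e) p by [].
case: (boolP (x \in y :: map (@ter G) q)) => [|xq]; last first.
  have wx : is_walk x (e :: q) by rewrite /= ex -yE.
  have nd : List.NoDup (x :: map (@ter G) (e :: q)).
    by move/NoDupP: ndq => ndq; apply/NoDupP; rewrite /= -yE xq.
  exists (@DPath _ x (e :: q) wx nd); split=> //.
    by rewrite /walk_end /= -/(walk_end _ _) -qE yE.
  by move=> f /=; rewrite !inE => /orP[->//|/sq ->]; rewrite orbT.
rewrite /walk_end /= -/(walk_end _ _) -qE => {IHp qE yE ex}.
have {sq} : forall f, f \in q -> f \in e :: p.
  by move=> f /sq fp; rewrite inE fp orbT.
(* The start [x] already lies on [q]; the tail of [q] from there on is the path. *)
elim: q y wq ndq => [|f q IHq] y /= wq ndq sq.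
  by rewrite inE => /eqP ->; exists (@DPath _ y [::] wq ndq).
rewrite inE => /orP[/eqP->|xq]; first by exists (@DPath _ y (f :: q) wq ndq).
apply: (IHq (ter f)) => //; first by case: wq.
  by move: ndq; rewrite List.NoDup_cons_iff => -[].
by move=> g gq; apply: sq; rewrite inE gq orbT.
Qed.

Lemma walk_out X x p : is_walk x p -> X x -> ~ X (walk_end x p) ->
  exists2 e, e \in p & X (init e) /\ ~ X (ter e).
Proof.
elim: p x => [|e p IHp] x /=; first by [].
move=> [ex wp] Xx nX; case: (pselect (X (ter e))) => Xe; last first.
  by exists e; rewrite ?mem_head // ex.
have [f fp Xf] := IHp _ wp Xe nX.
by exists f => //; rewrite inE fp orbT.
Qed.

Lemma infinite_walk_out (t : nat -> edge G) X i j :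
  (forall n, ter (t n) = init (t n.+1)) -> i <= j ->
  X (init (t i)) -> ~ X (init (t j)) ->
  exists k, [/\ i <= k, k < j & out setT X (t k)].
Proof.
move=> wt /subnKC <-; move: (j - i) => d; elim: d i => [|d IHd] i.
  by rewrite addn0.
move=> Xi nX; case: (pselect (X (init (t i.+1)))) => Xi1; last first.
  by exists i; split; rewrite ?leqnn ?addnS ?ltnS ?leq_addr //; split; rewrite ?wt.
have [|k [ik kj ok]] := IHd i.+1 Xi1; first by rewrite addSnnS.
by exists k; split=> //; [apply: ltnW|rewrite -addSnnS].
Qed.

(** Disjointness puts each element of [C] into at most one [F i]. *)
Lemma finite_disjoint_meeting (I T : Type) (D : set I) (F : I -> set T)
    (C : set T) :
  finite_set C -> trivIset D F -> (forall i, D i -> F i `&` C !=set0) ->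
  finite_set D.
Proof.
move=> fC tF FC; apply: (@sub_finite_set _ _
    (\bigcup_(e in C) [set i | D i /\ F i e])).
  by move=> i Di; have [e [Fe Ce]] := FC i Di; exists e.
apply: bigcup_finite => // e _.
case: (pselect (exists i, D i /\ F i e)) => [[i [Di Fi]]|no].
  apply: (@sub_finite_set _ _ [set i]); last exact: finite_set1.
  by move=> j [Dj Fj]; apply: tF => //; exists e.
apply: (@sub_finite_set _ _ set0); last exact: finite_set0.
by move=> j Dj; apply: no; exists j.
Qed.

Lemma path_out X (p : dpath G) : X (path_start p) -> ~ X (path_end p) ->
  path_edge_set p `&` out setT X !=set0.
Proof.
move=> Xs nXe; have [e ep Xe] := walk_out (path_is_walk p) Xs nXe.
by exists e; split; [apply/InP|case: Xe].
Qed.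

Lemma finite_cut_not_dominating B X U : finite_cut B X -> U `<=` X ->
  ~ inf_edge_disjoint_paths U B.
Proof.
move=> [fX XB] UX [P [infP tP PUB]]; apply: infP.
apply: finite_disjoint_meeting fX tP _ => p /PUB[Up Bp].
by apply: path_out; [apply: UX|move/XB].
Qed.

(** Let [P] be a maximal edge-disjoint set of paths from [U] to [B]. If it were finite, with edges
    [F], the vertices that cannot reach [B] without using [F] would form a finite cut, all its
    outgoing edges being in [F]. Some vertex of [U] outside this cut would then give a further
    path. *)
Lemma dominating B U : (forall v, U v -> ~ B v) ->
  (forall X, finite_cut B X -> ~ U `<=` X) -> inf_edge_disjoint_paths U B.
Proof.
move=> UB Ucut.
have [P [PD tP maxP]] := ex_maximal_disjoint_subcollection
  (@path_edge_set G) [set p | U (path_start p) /\ B (path_end p)].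
exists P; split=> // fP.
pose F := \bigcup_(p in P) path_edge_set p.
have fF : finite_set F.
  apply: bigcup_finite => // p _; apply: sub_finite_set (finite_seq (path_edges p)).
  by move=> e /InP.
pose X := [set v | ~ exists p,
  [/\ is_walk v p, B (walk_end v p) & forall e, e \in p -> ~ F e]].
have cX : finite_cut B X.
  split; last by move=> v Xv Bv; apply: Xv; exists [::].
  apply: sub_finite_set fF => e [_ Xe /contrapT[p [wp Bp pF]]].
  apply: contrapT => nFe; apply: Xe; exists (e :: p); split=> //.
  by move=> f; rewrite inE => /orP[/eqP->|/pF].
have /existsNP[u /not_implyP[Uu /contrapT[p [wp Bp pF]]]] := Ucut X cX.
have [q [qs qe qp]] := walk_dpath wp.
have qF : path_edge_set q `&` F = set0.
  by apply/seteqP; split=> // e [/InP /qp /pF].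
(* As [U] misses [B], the path [q] has an edge, and this edge is not in [F]; a trivial path could
   already be in [P]. *)
have nPq : ~ P q.
  move=> Pq; have : path_edge_set q `&` out setT U !=set0.
    by apply: path_out; rewrite ?qs // qe => /UB.
  case=> e [qe' _]; have : (path_edge_set q `&` F) e by split=> //; exists q.
  by rewrite qF.
apply: (maxP (P `|` [set q])).
- split; first by move=> ? ?; left.
  by move/(_ q (or_intror erefl)).
- by move=> r [/PD //|->]; split; rewrite ?qs ?qe.
- have qr r e : P r -> path_edge_set r e -> ~ path_edge_set q e.
    move=> Pr re qe'; have : (path_edge_set q `&` F) e by split=> //; exists r.
    by rewrite qF.
  move=> i j [Pi|->] [Pj|->] // -[e [ie je]]; first by apply: tP => //; exists e.
    by case: (qr i e).
  by case: (qr j e).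
Qed.

Lemma cut_meets_path_or_ray B X q : finite_cut B X -> X (pr_start q) ->
  ends_in_or_dominates q B -> pr_edge_set q `&` out setT X !=set0.
Proof.
case: q => [p|r] /= cX Xs => [hB|rB].
  apply: path_out => // Xe; case: hB; first by case: cX => _ /(_ _ Xe).
  by apply: (finite_cut_not_dominating cX) => _ ->.
have /existsNP[_ /not_implyP[[n _ <-] nXn]] : ~ ray_vertex_set r `<=` X.
  by move=> rX; apply: (finite_cut_not_dominating cX rX).
have [k [_ _ ok]] := infinite_walk_out (@ray_is_walk _ r) (leq0n n) Xs nXn.
by exists (ray_edge r k); split=> //; exists k.
Qed.

(** Phrased with duplicate-free lists, because [ncard] would count an infinite intersection of [S]
    and [X] as 0; this form forces the intersection to be finite. *)
Definition hall S B : Prop := forall X s, finite_cut B X -> uniq s ->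
  (forall v, v \in s -> S v /\ X v) -> size s <= ncard (out setT X).

Lemma linkage_hall S B Q : domination_linkage S B Q -> hall S B.
Proof.
move=> [Q_ tQ] X [//|v0 s0] cX; set s := v0 :: s0 => us sSX.
have QX v : v \in s -> pr_edge_set (Q v) `&` out setT X !=set0.
  move=> /sSX[Sv Xv]; have [Qs QB] := Q_ v Sv.
  by apply: cut_meets_path_or_ray cX _ QB; rewrite Qs.
have [e0 _] := QX v0 (mem_head _ _).
have /choice[f fP] : forall v, exists e, v \in s ->
    pr_edge_set (Q v) e /\ out setT X e.
  move=> v; case: (boolP (v \in s)) => [/QX[e]|_]; last by exists e0.
  by exists e.
rewrite -(size_map f); apply: size_le_ncard.
- exact: finite_out cX.
- rewrite map_inj_in_uniq // => u v us' vs fuv.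
  apply: tQ; [by case: (sSX u)|by case: (sSX v)|].
  by exists (f u); split; [case: (fP u)|rewrite fuv; case: (fP v)].
- by move=> e /mapP[v vs ->]; case: (fP v vs).
Qed.

Lemma flow_linkage Y F L : uniq F -> uniq L ->
  (forall e, e \in F -> Y (init e)) -> flow Y F L ->
  exists P : vertex G -> seq (edge G),
    (forall v, v \in L -> [/\ is_walk v (P v), ~ Y (walk_end v (P v)) &
       forall e, e \in P v -> e \in F]) /\
    (forall u v e, u \in L -> v \in L -> e \in P u -> e \in P v -> u = v).
Proof.
elim: L F => [|x L IHL] F uF /= => [_ _ _|/andP[xL uL] FY FL].
  by exists (fun=> [::]).
have [r [F' [wr pF nYr FL']]] := flow_walk FY FL.
have rF e : e \in r -> e \in F by rewrite (perm_mem pF) mem_cat => ->.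
have F'F e : e \in F' -> e \in F by rewrite (perm_mem pF) mem_cat orbC => ->.
have rF' e : e \in r -> e \notin F'.
  move: uF; rewrite (perm_uniq pF) cat_uniq => /and3P[_ /hasPn dis _] er.
  by apply: contraL er => /dis.
have [||P [P1 P2]] := IHL F' _ uL _ FL'.
- by move: uF; rewrite (perm_uniq pF) cat_uniq => /and3P[].
- by move=> e /F'F /FY.
have vx v : v \in L -> v == x = false.
  by move=> vL; apply: contraNF xL => /eqP <-.
exists (fun v => if v == x then r else P v); split.
  move=> v; rewrite inE; case: eqP => [-> _|_ /= vL]; first by [].
  by case: (P1 v vL) => ? ? PF'; split=> // e /PF' /F'F.
move=> u v e; rewrite !inE.
case: eqP => [-> _|_ /= uL']; case: eqP => [-> _|_ /= vL] //.
- by move=> /rF' /negP er eP; case: (P1 v vL) => _ _ /(_ _ eP).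
- by move=> eP /rF' /negP er; case: (P1 u uL') => _ _ /(_ _ eP).
- exact: P2.
Qed.

(** With the complement of [B] as [Y], leaving [Y] means reaching [B], so a flow with one token on
    each vertex of [S] splits into the desired walks. *)
Lemma hall_linked S B : finite_set S -> hall S B -> can_be_linked S B.
Proof.
move=> fS hS; have [L [uL LS _]] := ncard_enum fS.
have [||X cX _|F [uF FY FL]] := @flow_exists G B setT (~` B) L.
- by move=> v.
- apply: (@sub_finite_set _ _ set0); last exact: finite_set0.
  by move=> e [_ []].
- rewrite /tokens -size_filter; apply: hS => //; first exact: filter_uniq.
  by move=> v; rewrite mem_filter => /andP[/asboolP Xv /LS].
have [|P [P1 P2]] := flow_linkage uF uL _ FL; first by move=> e /FY[].
have /choice[Q QP] : forall v, exists q : dpath G, v \in L ->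
    [/\ path_start q = v, B (path_end q) &
       forall e, e \in path_edges q -> e \in P v].
  move=> v; case: (boolP (v \in L)) => [/P1[wP eP _]|_].
    have [q [qs qe qP]] := walk_dpath wP; exists q => _; split=> //.
    by rewrite qe; apply: contrapT.
  by have [q _] := @walk_dpath v [::] I; exists q.
exists Q; split; first by move=> s /LS /QP[].
move=> u v /LS uL' /LS vL [e [/InP eu /InP ev]].
by apply: (P2 u v e) => //; [case: (QP u uL')|case: (QP v vL)] => _ _; exact.
Qed.

Lemma linked_hall S B : can_be_linked S B -> hall S B.
Proof.
move=> [P [P_ tP]]; apply: (@linkage_hall S B (fun v => inl (P v))).
by split=> // a /P_[Ps PB]; split=> //; left.
Qed.

End Walks.

Lemma exists_argmin (T : Type) (P : set T) (f : T -> nat) : P !=set0 ->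
  exists2 x, P x & forall y, P y -> f x <= f y.
Proof.
move=> [x0 Px0].
have ex : exists n, `[< exists2 x, P x & f x = n >].
  by exists (f x0); apply/asboolP; exists x0.
case: (ex_minnP ex) => _ /asboolP[x Px <-] min.
by exists x => // y Py; apply: min; apply/asboolP; exists y.
Qed.

(** * Moving a token out of finite cuts *)

Section Exit.
Variable G : digraph.
Implicit Types (H : set (edge G)) (X Y Z B D : set (vertex G)).
Implicit Types (r : seq (edge G)) (x : vertex G).

Definition feasible B H D : Prop := forall X, finite_cut B X ->
  ncard (D `&` X) <= ncard (out H X).

Definition token_feasible B H D x : Prop := forall X, finite_cut B X ->
  ncard (D `&` X) + `[< X x >] <= ncard (out H X).

(** An edge that ends outside [Z] can have no successor starting in [Z], so it is the last one. *)
Lemma walk_leaving_once Z x r e : is_walk x r ->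
  (forall f, f \in r -> Z (init f)) -> e \in r -> ~ Z (ter e) ->
  walk_end x r = ter e /\ forall f, f \in r -> ~ Z (ter f) -> f = e.
Proof.
elim: r x => [//|f [|g r] IHr] x wr rZ.
  by rewrite inE => /eqP -> _; split=> // h; rewrite inE => /eqP.
have Zf : Z (ter f).
  have -> : ter f = init g by case: wr => _ [].
  by apply: rZ; rewrite !inE eqxx orbT.
rewrite inE => /orP[/eqP->//|er nZe].
have [||eE uE] := IHr (ter f) _ _ er nZe; first by case: wr.
  by move=> h hr; apply: rZ; rewrite inE hr orbT.
split=> // h; rewrite inE => /orP[/eqP->//|]; exact: uE.
Qed.

Lemma exit_cut B H D x Y :
  (forall X, finite_cut B X -> finite_set (D `&` X)) ->
  (forall X, finite_cut B X -> finite_set [set e | X (init e) /\ ~ H e]) ->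
  token_feasible B H D x -> finite_cut B Y -> Y x ->
  exists r, [/\ is_walk x r /\ uniq r, forall e, e \in r -> H e,
    exists2 Z, finite_cut B Z & forall e, e \in r -> Z (init e),
    ~ Y (walk_end x r) &
    token_feasible B (H `\` [set` r]) D (walk_end x r)].
Proof.
move=> fD fH feas cY Yx.
(* The exit is made from a superset [Z] of [Y] of least excess, so that by
   submodularity only cuts inside [Z], where a flow is available, matter. *)
have [|Z [cZ YZ] minZ] := @exists_argmin _ [set Z | finite_cut B Z /\ Y `<=` Z]
  (fun Z => ncard (out H Z) - ncard (D `&` Z)); first by exists Y; split.
have [s [us sP _]] := ncard_enum (fD Z cZ).
have tok W : W `<=` Z -> tokens s W = ncard (D `&` W).
  move=> WZ; rewrite /tokens -(count_uniq_ncard W us); congr ncard.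
  apply/seteqP; split=> v; first by move=> [Wv /sP[]].
  by move=> [Dv Wv]; split=> //; apply/sP; split=> //; apply: WZ.
have [||W cW WZ|F [uF FHZ FL]] := @flow_exists G B H Z (x :: s).
- by case: cZ.
- exact: fH.
- by rewrite /tokens /= -/(tokens s W) tok // addnC; apply: feas.
have [|r [F' [wr pF nZr FL']]] := flow_walk _ FL; first by move=> e /FHZ[].
have rF e : e \in r -> e \in F by rewrite (perm_mem pF) mem_cat => ->.
have F'F e : e \in F' -> e \in F by rewrite (perm_mem pF) mem_cat orbC => ->.
move: uF; rewrite (perm_uniq pF) cat_uniq => /and3P[ur /hasPn rF' uF'].
exists r; split=> //; first by move=> e /rF /FHZ[].
- by exists Z => // e /rF /FHZ[].
- by move=> /YZ.
move=> X cX; set H' := H `\` _; set y := walk_end x r.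
have Zx : Z x by apply: YZ.
have [e0 e0r [Ze0 nZe0]] := walk_out wr Zx nZr.
have [|yE uniq_e0] := walk_leaving_once wr _ e0r nZe0.
  by move=> f /rF /FHZ[].
have cI := finite_cutI cX cZ; have cU := finite_cutU cX cZ.
(* Inside [Z] the remaining flow [F'] still serves the vertices of [D]. *)
have b : ncard (D `&` (X `&` Z)) <= ncard (out H' (X `&` Z)).
  rewrite -tok; last by move=> v [].
  apply: leq_trans (_ : outdeg F' (X `&` Z) <= _).
    by rewrite FL' ?leq_addl // => v [].
  rewrite /outdeg -size_filter; apply: size_le_ncard.
  - exact: finite_out cI.
  - exact: filter_uniq.
  move=> e; rewrite mem_filter => /andP[/asboolP[h1 h2] eF']; split=> //; split.
    by have [] := FHZ e (F'F _ eF').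
  exact/negP/rF'.
have c : ncard (out H' Z) + 1 <= ncard (out H Z).
  rewrite -[leqRHS]addn0 -(ncard_set1 e0) -(ncard0 (edge G)).
  apply: ncard_leD; [exact: finite_out cZ|exact: finite_set0|..].
    move=> e [[[He _] Zi Zt]|->]; left; split=> //.
    by have [] := FHZ e0 (rF _ e0r).
  by move=> e [[[_ er] _ _] ee0]; case: er; rewrite /= ee0.
(* The only edge of the walk that can leave the union is [e0], and only if its end [y] is outside
   [X]. *)
have d : ncard (out H (X `|` Z)) <= ncard (out H' (X `|` Z)) + `[< ~ X y >].
  have fU := finite_out H' cU.
  have sub e : out H (X `|` Z) e -> ~ out H' (X `|` Z) e -> e = e0 /\ ~ X y.
    move=> [He XZe /not_orP[nXt nZt]] nH'.
    have er : e \in r.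
      apply: contrapT => er; apply: nH'; split=> //; exact/not_orP.
    have ee0 := uniq_e0 e er nZt; split=> //.
    by rewrite /y yE -ee0.
  case: (pselect (X y)) => Xy.
    rewrite asboolF // addn0; apply: ncard_le => // e oe.
    by apply: contrapT => /(sub e oe)[_].
  rewrite asboolT // -[nat_of_bool true]/1 -(ncard_set1 e0) -[leqLHS]addn0 -(ncard0 (edge G)).
  apply: ncard_leD => //.
    move=> e [oe|//]; case: (pselect (out H' (X `|` Z) e)); first by left.
    by move=> /(sub e oe)[-> _]; right.
  by move=> e [].
(* Submodularity [a] bounds the out-degree of [X] in [H'] from below; [b], [c] and [d] estimate its
   other terms, [e] is the least excess of [Z], and [f] the modularity of counting [D]. Feasibility
   of [Z] and of the union keeps the truncated subtractions in [e] exact. *)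
have a := out_submodular (finite_out H' cX) (finite_out H' cZ).
have e : ncard (out H Z) - ncard (D `&` Z) <=
         ncard (out H (X `|` Z)) - ncard (D `&` (X `|` Z)).
  by apply: minZ; split=> // v Yv; right; apply: YZ.
have f : ncard (D `&` X) + ncard (D `&` Z) <=
         ncard (D `&` (X `&` Z)) + ncard (D `&` (X `|` Z)).
  apply: ncard_leD; [exact: fD|exact: fD|..].
    by move=> v [[Dv Xv]|[Dv Zv]]; right; split=> //; [left|right].
  by move=> v [[Dv Xv] [_ Zv]]; split; split=> //; left.
have := feas _ cU; have := feas _ cZ; rewrite asboolT //.
move: d; rewrite asbool_neg; case: `[< X y >] => /=; lia.
Qed.

Definition saturated B C Y : Prop :=
  [/\ finite_cut B Y, C `<=` Y,
    forall Z, finite_cut B Z -> C `<=` Z ->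
      ncard (out setT Y) <= ncard (out setT Z) &
    forall Z, finite_cut B Z -> Y `<=` Z ->
      ncard (out setT Z) <= ncard (out setT Y) -> Z `<=` Y].

(** Fix the least out-degree [k] and apply Zorn's lemma. Any finite list of edges leaving the union
    of a chain leaves a single member already, so the union has out-degree at most [k] too. *)
Lemma saturated_exists B C Y : C !=set0 -> finite_cut B Y -> C `<=` Y ->
  exists Z, saturated B C Z.
Proof.
move=> [x Cx] cY CY.
have [|Z0 [cZ0 CZ0] minZ0] := @exists_argmin _
  [set Z | finite_cut B Z /\ C `<=` Z] (fun Z => ncard (out setT Z)).
  by exists Y; split.
set k := ncard _ in minZ0.
pose P := [set Z : set (vertex G) | Z !=set0 ->
  [/\ finite_cut B Z, C `<=` Z & ncard (out setT Z) <= k]].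
have [F FP totF|M [PM maxM]] := @Zorn_bigcup _ P.
  move=> [v [X FX Xv]].
  have [cX CX kX] := FP X FX (ex_intro _ v Xv).
  have [fU kU] : finite_set (out setT (\bigcup_(Z in F) Z)) /\
      ncard (out setT (\bigcup_(Z in F) Z)) <= k.
    apply: ncard_le_sizes => s us so.
    have [||||Z [FZ Z0'] ZP] := @chain_common _ _ [set Z | F Z /\ Z !=set0]
      (fun e Z => Z (init e)) s.
    - by exists X; split=> //; exists v.
    - by move=> U V [FU _] [FV _]; apply: totF.
    - by move=> e U V UV /UV.
    - by move=> e /so[_ [Z FZ Ze] _]; exists Z => //; split=> //; exists (init e).
    have [cZ _ kZ] := FP Z FZ Z0'.
    apply: leq_trans kZ; apply: size_le_ncard => //; first by case: cZ.
    move=> e es; split=> //; first exact: ZP.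
    by move=> Zt; have [_ _] := so e es; apply; exists Z.
  split=> //; last by move=> w /CX Xw; exists X.
  split=> // w [Z FZ Zw]; have [[_ ZB] _ _] := FP Z FZ (ex_intro _ w Zw).
  exact: ZB.
have Mx : M !=set0.
  apply/set0P/eqP => M0; apply: (maxM Z0); last by [].
  by rewrite M0; split=> //; move=> /(_ x (CZ0 x Cx)).
have [cM CM kM] := PM Mx.
exists M; split=> //.
  by move=> Z cZ CZ; apply: leq_trans kM _; apply: minZ0.
move=> Z cZ MZ kZ; apply: contrapT => nZM; apply: (maxM Z); first by split.
by move=> _; split=> //; [apply: subset_trans MZ|apply: leq_trans kM].
Qed.

(* If [X] contained all late [x m], its union with the [Y n] would have bounded
   out-degree and yet majorise [Y n], whose out-degree is at least [n]. *)
Lemma milestones_leave B (x : nat -> vertex G) (Y : nat -> set (vertex G)) :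
  (forall n, finite_cut B (Y n)) ->
  (forall n, saturated B (Y n `|` [set x n]) (Y n.+1)) ->
  (forall n, ~ Y n.+1 (x n.+1)) ->
  forall X N, finite_cut B X -> exists2 m, N <= m & ~ X (x m).
Proof.
move=> cY satY nY X N cX; apply: contrapT => noX.
have Xx m : N <= m -> X (x m).
  by move=> Nm; apply: contrapT => ?; apply: noX; exists m.
(* If [Y n.+2] had no larger out-degree than [Y n.+1], maximality of the latter would put [x n.+1]
   into it. *)
have dY n : n <= ncard (out setT (Y n.+1)).
  elim: n => // n IHn; rewrite ltnNge; apply/negP => dn.
  have [_ YY1 minY maxY] := satY n.
  have [_ YY2 _ _] := satY n.+1.
  have YS : Y n.+1 `<=` Y n.+2 by move=> v Yv; apply: YY2; left.
  apply: (nY n); apply: (maxY (Y n.+2)) => //.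
    exact: leq_trans dn IHn.
  by apply: YY2; right.
pose K := ncard (out setT (X `|` Y N)).
have W j : exists W, [/\ finite_cut B W, Y (N + j) `<=` W,
    forall m, N <= m -> W (x m) & ncard (out setT W) <= K].
  elim: j => [|j [W [cW YW xW kW]]].
    exists (X `|` Y N); split; rewrite ?addn0 //.
    - exact: finite_cutU.
    - by move=> m Nm; left; apply: Xx.
  have [_ YY1 minY _] := satY (N + j); rewrite addnS.
  exists (W `|` Y (N + j).+1); split.
  - exact: finite_cutU.
  - by move=> v Yv; right.
  - by move=> m Nm; left; apply: xW.
  (* The intersection of [W] with the next milestone contains the previous milestone and its [x], so
     its out-degree is at least that of the next milestone; hence the union has out-degree at most
     that of [W]. *)
  have := out_submodular (finite_out setT cW) (finite_out setT (cY (N + j).+1)).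
  have := minY _ (finite_cutI cW (cY (N + j).+1)).
  have sub : Y (N + j) `|` [set x (N + j)] `<=` W `&` Y (N + j).+1.
    move=> v Yv; split; last exact: YY1.
    by case: Yv => [/YW //|->]; apply: xW; rewrite leq_addr.
  move=> /(_ sub); lia.
(* The milestone after [Y (N + K.+1)] has out-degree above [K], but by minimality at most that of
   [W']. *)
have [W' [cW' YW' xW' kW']] := W K.+1.
have [_ _ minY _] := satY (N + K.+1).
have := minY _ cW'; have := dY (N + K.+1).
have sub : Y (N + K.+1) `|` [set x (N + K.+1)] `<=` W'.
  by move=> v [/YW' //|->]; apply: xW'; rewrite leq_addr.
move=> h /(_ sub); lia.
Qed.

End Exit.

(** * Infinite trails and their rays *)

Section Trail.
Variable G : digraph.
Implicit Types (H : set (edge G)) (X Y Z B D : set (vertex G)).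

Lemma is_walk_nth e0 (x : vertex G) p i : is_walk x p -> i.+1 < size p ->
  ter (nth e0 p i) = init (nth e0 p i.+1).
Proof.
elim: p x i => [//|e [//|f p] IHp] x [|i] [_ wp]; first by case: wp.
exact: IHp wp.
Qed.

Variable t : nat -> edge G.
Hypothesis walk_t : forall n, ter (t n) = init (t n.+1).

Lemma injective_eventually_notin (s : seq (edge G)) : injective t ->
  exists M, forall k, M <= k -> t k \notin s.
Proof.
move=> inj_t; elim: s => [|e s [M Ms]]; first by exists 0.
case: (pselect (exists k, t k = e)) => [[j tj]|no].
  exists (maxn M j.+1) => k; rewrite geq_max => /andP[/Ms ks jk].
  rewrite inE negb_or ks andbT -tj; apply: contraTneq jk => /inj_t ->.
  by rewrite ltnn.
exists M => k /Ms ks; rewrite inE negb_or ks andbT.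
by apply/eqP => tk; apply: no; exists k.
Qed.

(** The trail uses each of the finitely many edges leaving [X] at most once. After that, entering
    [X] would mean staying there for good. *)
Lemma eventually_outside X : injective t -> finite_set (out setT X) ->
  (forall N, exists2 m, N <= m & ~ X (init (t m))) ->
  exists M, forall m, M <= m -> ~ X (init (t m)).
Proof.
move=> inj_t /finite_seqP[s sE] io.
have [M0 M0P] := injective_eventually_notin s inj_t.
have [M M0M nXM] := io M0; exists M => m Mm Xm.
have [m2 mm2 nXm2] := io m.
have [k [mk _ ok]] := infinite_walk_out walk_t mm2 Xm nXm2.
have := M0P k (leq_trans M0M (leq_trans Mm mk)).
by move=> /negP; apply; rewrite -/([set` s] (t k)) -sE.
Qed.

(** Go to the last visit of the current vertex, take the next edge of the walk, and repeat; a vertex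
    left at its last visit never recurs. *)
Lemma ray_of_last_visits :
  (forall v, exists M, forall m, M <= m -> init (t m) <> v) ->
  exists (r : dray G) (f : nat -> nat), [/\ forall k, ray_edge r k = t (f k),
    {homo f : i j / i < j} & ray_start r = init (t 0)].
Proof.
move=> fin.
have /choice[l lP] : forall i, exists j, [/\ i <= j, init (t j) = init (t i) &
    forall k, j < k -> init (t k) <> init (t i)].
  (* The last visit is the predecessor of the least bound [M]. *)
  move=> i; have [M MP minM] := exists_argmin id (fin (init (t i))).
  have iM : i < M by rewrite ltnNge; apply/negP => /MP.
  case: M => // M in MP minM iM *; exists M; split=> //.
  apply: contrapT => nM; suff /minM : forall m, M <= m -> init (t m) <> init (t i).
    by rewrite ltnn.
  by move=> m; rewrite leq_eqVlt => /orP[/eqP <- //|/MP].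
pose f := fix f k := if k is k'.+1 then l (f k').+1 else l 0.
have visit k : exists2 i, init (t (f k)) = init (t i) & f k = l i.
  case: k => [|k]; first by exists 0 => //; case: (lP 0).
  by exists (f k).+1 => //; case: (lP (f k).+1).
have fS k : f k < f k.+1 by case: (lP (f k).+1).
have homo_f : {homo f : i j / i < j} by apply: homo_ltn => //; apply: ltn_trans.
have inj_f i j : i < j -> init (t (f i)) <> init (t (f j)).
  move=> /homo_f ij; have [n -> fn] := visit i.
  by apply/nesym; have [_ _] := lP n; apply; rewrite -fn.
have walk_f k : ter (t (f k)) = init (t (f k.+1)).
  by rewrite walk_t; case: (lP (f k).+1).
have nodup_f : injective (fun k => init (t (f k))).
  move=> i j /= ij; case: (ltngtP i j) => // /inj_f; first by [].
  by move/nesym.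
by exists (DRay walk_f nodup_f), f; split=> //; case: (lP 0).
Qed.

End Trail.

(** * Linking one more vertex *)

Section Step.
Variable G : digraph.
Implicit Types (H : set (edge G)) (X Y Z B D : set (vertex G)).

(** This keeps the used edges starting in a finite cut finite in number. An arbitrary dominating ray
    can fail it, since its tail may stay inside a finite cut. *)
Definition crosses_cuts B (E : set (edge G)) : Prop := forall X,
  finite_cut B X -> finite_set (E `&` [set e | X (init e)]) /\
  (E `&` [set e | X (init e)] !=set0 -> E `&` out setT X !=set0).

Lemma dpath_crosses_cuts B (q : dpath G) :
  (forall X, finite_cut B X -> ~ X (path_end q)) ->
  crosses_cuts B (path_edge_set q).
Proof.
move=> qB X cX; split.
  apply: finite_setIl; apply: sub_finite_set (finite_seq (path_edges q)).
  by move=> e /InP.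
move=> [e [/InP eq Xe]]; have := path_is_walk q; have := qB X cX.
rewrite /path_end -/(walk_end _ _).
case/splitPr eqE: {1 2}(path_edges q) / eq => [p1 p2] nX wq.
move: wq nX; rewrite walk_end_cat => /is_walk_cat[_ [ei wp2]] nX.
have [|f fp [Xf nXf]] := @walk_out G X (init e) (e :: p2) _ Xe nX.
  by split.
by exists f; split=> //; apply/InP; rewrite eqE mem_cat fp orbT.
Qed.

Lemma extend_linkage B H D a :
  (forall X, finite_cut B X -> finite_set (D `&` X)) ->
  (forall X, finite_cut B X -> finite_set [set e | X (init e) /\ ~ H e]) ->
  token_feasible B H D a ->
  exists q : path_or_ray G, [/\ pr_start q = a, ends_in_or_dominates q B,
    pr_edge_set q `<=` H, crosses_cuts B (pr_edge_set q) &
    feasible B (H `\` pr_edge_set q) D].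
Proof.
move=> fD fH feas.
(* The third clause keeps the initial vertices of the edges in finite cuts, hence outside [B]. *)
pose trail p := [/\ is_walk a p /\ uniq p, forall e, e \in p -> H e,
  forall e, e \in p -> exists2 Z, finite_cut B Z & Z (init e) &
  token_feasible B (H `\` [set` p]) D (walk_end a p)].
case: (pselect (exists2 p, trail p &
    forall X, finite_cut B X -> ~ X (walk_end a p))) => [[p tp pB]|noend].
  have [[wp up] pH _ feasp] := tp.
  have [q [qs qe qp]] := walk_dpath wp.
  exists (inl q) => /=; split=> //.
  - case: (pselect (B (path_end q))) => [|nB]; [by left|right].
    apply: dominating => [_ -> //|X cX sX].
    by apply: (pB X cX); rewrite -qe; apply: sX.
  - by move=> e /InP /qp /pH.
  - by apply: dpath_crosses_cuts; rewrite qe.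
  - move=> X cX; apply: leq_trans (leq_trans (leq_addr _ _) (feasp X cX)) _.
    apply: ncard_le; first exact: finite_out cX.
    by apply: out_sub => e [He ep]; split=> // /InP /qp.
(* A state is the trail so far with the last finite cut it has left; a step adds the current
   position to this cut, saturates, and exits. *)
pose state := {s : seq (edge G) * set (vertex G) |
  [/\ trail s.1, finite_cut B s.2 & ~ s.2 (walk_end a s.1)]}.
have /choice[next nextP] : forall s : state, exists s' : state,
    (exists2 r, r != [::] & (sval s').1 = (sval s).1 ++ r) /\
    saturated B ((sval s).2 `|` [set walk_end a (sval s).1]) (sval s').2.
  move=> [[p Y] /= [tp cY nY]]; have [[wp up] pH pZ feasp] := tp.
  have [Z cZ Zp] : exists2 Z, finite_cut B Z & Z (walk_end a p).
    apply: contrapT => noZ; apply: noend; exists p => // X cX Xp.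
    by apply: noZ; exists X.
  have [|||Y' satY'] :=
      @saturated_exists _ B (Y `|` [set walk_end a p]) (Y `|` Z).
  - by exists (walk_end a p); right.
  - exact: finite_cutU.
  - by move=> v [Yv|->]; [left|right].
  have [cY' YY' _ _] := satY'.
  have Y'p : Y' (walk_end a p) by apply: YY'; right.
  have [|r [[wr ur] rH [Z' cZ' rZ'] nYr feasr]] := exit_cut fD _ feasp cY' Y'p.
    move=> X cX; apply: (@sub_finite_set _ _
      ([set e | X (init e) /\ ~ H e] `|` [set` p])); last first.
      by rewrite finite_setU; split; [apply: fH|].
    move=> e [Xe /not_andP[nH|/contrapT ep]]; [by left|by right].
  have tr : trail (p ++ r).
    split.
    - split; first exact/is_walk_cat.
      rewrite cat_uniq up ur andbT; apply/hasPn => e /rH[_ /negP ep].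
      exact: ep.
    - by move=> e; rewrite mem_cat => /orP[/pH //|/rH[]].
    - by move=> e; rewrite mem_cat => /orP[/pZ //|/rZ' ?]; exists Z'.
    - suff -> : H `\` [set` p ++ r] = (H `\` [set` p]) `\` [set` r].
        by rewrite walk_end_cat.
      apply/seteqP; split=> e /=; rewrite mem_cat.
        by move=> [He /negP]; rewrite negb_or => /andP[/negP ? /negP].
      by move=> [[He /negP ep] /negP er]; split=> //; apply/negP/norP.
  have st : [/\ trail (p ++ r, Y').1, finite_cut B (p ++ r, Y').2 &
      ~ (p ++ r, Y').2 (walk_end a (p ++ r, Y').1)].
    by rewrite /= walk_end_cat.
  exists (exist _ (p ++ r, Y') st) => /=; split=> //.
  by exists r => //; apply: contra_notN nYr => /eqP ->.
pose s0 : seq (edge G) * set (vertex G) := ([::], set0).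
have st0 : [/\ trail s0.1, finite_cut B s0.2 & ~ s0.2 (walk_end a s0.1)].
  split=> //; last first.
    split=> //; apply: (@sub_finite_set _ _ set0); last exact: finite_set0.
    by move=> e [].
  split=> //; rewrite /walk_end /= set_nil setD0; exact: feas.
pose s n := iter n next (exist _ s0 st0).
pose p n := (sval (s n)).1; pose Y n := (sval (s n)).2.
have tp n : trail (p n) by rewrite /p; case: (s n) => /= ? [].
have cY n : finite_cut B (Y n) by rewrite /Y; case: (s n) => /= ? [].
have nY n : ~ Y n (walk_end a (p n)).
  by rewrite /Y /p; case: (s n) => /= ? [].
have pS n : exists2 r, r != [::] & p n.+1 = p n ++ r.
  by case: (nextP (s n)).
have satY n : saturated B (Y n `|` [set walk_end a (p n)]) (Y n.+1).
  by case: (nextP (s n)).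
have size_p n : n <= size (p n).
  elim: n => // n IHn; have [[//|e r] _ ->] := pS n.
  by rewrite size_cat /=; lia.
have prefix_p m n : m <= n -> exists r, p n = p m ++ r.
  move=> /subnKC <-; elim: (n - m) => [|d [r IHd]].
    by exists [::]; rewrite addn0 cats0.
  have [r' _ pr'] := pS (m + d); exists (r ++ r').
  by rewrite addnS pr' IHd catA.
have [e0 _] : exists e0 : edge G, True.
  by have := size_p 1; case: (p 1) => // e ? _; exists e.
(* Each step adds an edge, so [p n.+1] has more than [n] edges and the default [e0] never
   matters. *)
pose t n := nth e0 (p n.+1) n.
have tE m i : i < size (p m) -> nth e0 (p m) i = t i.
  move=> im; rewrite /t; have [mi|im'] := leqP m i.+1.
    by have [r ->] := prefix_p _ _ mi; rewrite nth_cat im.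
  by have [r ->] := prefix_p _ _ (ltnW im'); rewrite nth_cat size_p.
have walk_t n : ter (t n) = init (t n.+1).
  have [[w _] _ _ _] := tp n.+2.
  have n2 : n.+1 < size (p n.+2) by apply: size_p.
  by rewrite -(tE _ _ (ltnW n2)) -(tE _ _ n2) (is_walk_nth e0 w).
have inj_t : injective t.
  move=> i j; set m := (maxn i j).+1.
  have im : i < size (p m) by apply: leq_trans (size_p m); rewrite ltnS leq_maxl.
  have jm : j < size (p m) by apply: leq_trans (size_p m); rewrite ltnS leq_maxr.
  rewrite -!(tE m) // => /eqP; have [[_ um] _ _ _] := tp m.
  by rewrite nth_uniq // => /eqP.
have t_end n : walk_end a (p n) = init (t (size (p n))).
  have [[//|e r] _ pr] := pS n.
  have [[w _] _ _ _] := tp n.+1; move: w; rewrite pr => /is_walk_cat[_ [<- _]].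
  by rewrite -(tE n.+1) pr ?nth_cat ?ltnn ?subnn // size_cat /= addnS ltnS leq_addr.
have t_in n : t n \in p n.+1 by rewrite mem_nth.
have tH n : H (t n) by have [_ pH _ _] := tp n.+1; apply: pH.
have tZ n : exists2 Z, finite_cut B Z & Z (init (t n)).
  by have [_ _ pZ _] := tp n.+1; apply: pZ.
have out_t X : finite_cut B X -> exists M, forall m, M <= m -> ~ X (init (t m)).
  move=> cX; apply: eventually_outside => // [|N]; first by case: cX.
  have [m Nm nX] := milestones_leave cY satY (fun n => nY n.+1) N cX.
  exists (size (p m)); last by rewrite -t_end.
  exact: leq_trans (size_p m).
have [|r [f [rt homo_f rs]]] := ray_of_last_visits walk_t.
  (* By [out_t] a vertex in a finite cut is visited finitely often; a vertex in no finite cut is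
     never visited. *)
  move=> v; case: (pselect (exists2 Z, finite_cut B Z & Z v)) => [[Z cZ Zv]|noZ].
    by have [M MP] := out_t Z cZ; exists M => m /MP nZ tv; apply: nZ; rewrite tv.
  by exists 0 => m _ tv; have [Z cZ Zt] := tZ m; apply: noZ; exists Z; rewrite -?tv.
have le_f k : k <= f k.
  by elim: k => // k IHk; apply: leq_ltn_trans IHk _; apply: homo_f.
exists (inr r) => /=; split.
- rewrite rs; have [[w _] _ _ _] := tp 1.
  rewrite /t; move: w (size_p 1); case: (p 1) => // e q [-> _] _.
  by [].
- apply: dominating => [_ [k _ <-]|X cX rX].
    by rewrite rt; have [Z [_ ZB] /ZB] := tZ (f k).
  have [M MP] := out_t X cX; apply: (MP (f M)) => //.
  by rewrite -rt; apply: rX; exists M.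
- by move=> _ [k _ <-]; rewrite rt.
- move=> X cX; have [M MP] := out_t X cX; split.
    apply: sub_finite_set (finite_seq [seq t i | i <- iota 0 M]).
    move=> _ [[k _ <-] /=]; rewrite rt => Xk; apply/mapP; exists (f k) => //.
    by rewrite mem_iota /= add0n ltnNge; apply/negP => /MP.
  move=> [_ [[k _ <-] Xk]].
  have Mk : ~ X (init (ray_edge r (maxn k M))).
    by rewrite rt; apply: MP; apply: leq_trans (le_f _); rewrite leq_maxr.
  have [j [_ _ oj]] := infinite_walk_out (@ray_is_walk _ r) (leq_maxl k M) Xk Mk.
  by exists (ray_edge r j); split=> //; exists j.
(* All edges of the ray that start in [X] occur in [p M], so feasibility after [M] steps suffices
   for [X]. *)
- move=> X cX; have [M MP] := out_t X cX; have [_ _ _ feasM] := tp M.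
  apply: leq_trans (leq_trans (leq_addr _ _) (feasM X cX)) _.
  apply: ncard_le; first exact: finite_out cX.
  move=> e [[He ep] Xe nXe]; split=> //; split=> // -[k _ ek].
  have kM : f k < size (p M).
    apply: leq_trans (size_p M); rewrite ltnNge; apply/negP => /MP.
    by rewrite -rt ek.
  by apply: ep; rewrite -ek rt -(tE M) //=; apply: mem_nth.
Qed.


End Step.

(** * Zorn's lemma on partial linkages *)

Section Linkage.
Variable G : digraph.
Implicit Types (H : set (edge G)) (X Y Z A B D : set (vertex G)).
Implicit Types M N : set (vertex G * path_or_ray G).

Definition used M : set (edge G) :=
  [set e | exists2 aq, M aq & pr_edge_set aq.2 e].

Definition unlinked A M : set (vertex G) :=
  [set a | A a /\ forall q, ~ M (a, q)].

(** With a set of pairs, made functional by [pl_fun], extension is inclusion and Zorn's lemma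
    applies to unions. *)
Record partial_linkage A B M : Prop := PartialLinkage {
  pl_dom : forall aq, M aq -> [/\ A aq.1, pr_start aq.2 = aq.1,
    ends_in_or_dominates aq.2 B & crosses_cuts B (pr_edge_set aq.2)];
  pl_disj : trivIset M (fun aq => pr_edge_set aq.2);
  pl_fun : forall a q q', M (a, q) -> M (a, q') -> q = q';
  pl_feas : feasible B (~` used M) (unlinked A M)
}.

Lemma hall_finite A B X : hall A B -> finite_cut B X ->
  finite_set (A `&` X) /\ ncard (A `&` X) <= ncard (out setT X).
Proof.
by move=> hA cX; apply: ncard_le_sizes => s us sAX; apply: hA.
Qed.

Lemma unlinkedS A M N : M `<=` N -> unlinked A N `<=` unlinked A M.
Proof. by move=> MN a [Aa nN]; split=> // q /MN /nN. Qed.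

(** Of the finitely many edges leaving a finite cut [X], those used by the union are all used by one
    member of the chain, whose feasibility at [X] carries over. *)
Lemma partial_linkage_bigcup A B (C : set (set (vertex G * path_or_ray G))) :
  hall A B -> C `<=` partial_linkage A B -> total_on C subset ->
  partial_linkage A B (\bigcup_(M in C) M).
Proof.
move=> hA CP totC; set U := \bigcup_(M in C) M.
have pair i j : U i -> U j -> exists2 M, C M & M i /\ M j.
  move=> [M CM Mi] [N CN Nj]; have [MN|NM] := totC _ _ CM CN.
    by exists N => //; split=> //; apply: MN.
  by exists M => //; split=> //; apply: NM.
split.
- by move=> aq [M /CP pM Maq]; apply: pl_dom pM _ Maq.
- move=> i j Ui Uj; have [M /CP pM [Mi Mj]] := pair i j Ui Uj.
  exact: (pl_disj pM).
- move=> a q q' Ui Uj; have [M /CP pM [Mi Mj]] := pair _ _ Ui Uj.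
  exact: pl_fun pM _ _ _ Mi Mj.
move=> X cX.
(* The union of the empty chain uses no edge, so the Hall condition itself applies. *)
case: (pselect (C !=set0)) => [C0|noC]; last first.
  have [fA leA] := hall_finite hA cX.
  apply: leq_trans (leq_trans leA _); apply: ncard_le => //.
  - by move=> a [[Aa _] Xa].
  - exact: finite_out cX.
  - by move=> e [_ Xe nXe]; split=> // -[aq [M CM _] _]; apply: noC; exists M.
have /finite_seqP[s sE] : finite_set (out setT X) by case: cX.
have [e M N MN [aq /MN Naq eq]|e|M CM Ms] := @chain_common _ _ C (fun e M => used M e)
    [seq e <- s | `[< used U e >]] C0 totC.
- by exists aq.
- rewrite mem_filter => /andP[/asboolP[aq [M CM Maq] eq] _].
  by exists M => //; exists aq.
have MU : M `<=` U by move=> aq; exists M.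
have [fA _] := hall_finite hA cX.
apply: leq_trans (leq_trans (pl_feas (CP M CM) cX) _).
  apply: ncard_le; last by move=> a [/(unlinkedS MU) ? ?].
  by apply: sub_finite_set fA => a [[? _] ?].
apply: ncard_le; first exact: finite_out cX.
move=> e [nMe Xe nXe]; split=> // Ue; apply: nMe; apply: Ms.
rewrite mem_filter asboolT //=; have : out setT X e by [].
by rewrite sE.
Qed.

Lemma partial_linkage_extend A B M a : hall A B -> partial_linkage A B M ->
  unlinked A M a -> exists q, partial_linkage A B (M `|` [set (a, q)]).
Proof.
move=> hA pM [Aa nMa]; pose D := unlinked A M `\ a.
have fUX X : finite_cut B X -> finite_set (unlinked A M `&` X).
  move=> cX; have [fA _] := hall_finite hA cX.
  by apply: sub_finite_set fA => v [[? _] ?].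
have fD X : finite_cut B X -> finite_set (D `&` X).
  by move=> cX; apply: sub_finite_set (fUX X cX) => v [[? _] ?].
(* Members with an edge starting in [X] also leave [X], through distinct edges, so there are
   finitely many of them, each with finitely many edges starting in [X]. *)
have fH X : finite_cut B X ->
    finite_set [set e | X (init e) /\ ~ (~` used M) e].
  move=> cX; pose XE := [set e : edge G | X (init e)].
  pose MX := [set aq | M aq /\ pr_edge_set aq.2 `&` XE !=set0].
  apply: (@sub_finite_set _ _ (\bigcup_(aq in MX) (pr_edge_set aq.2 `&` XE))).
    move=> e [Xe /contrapT[aq Maq qe]]; exists aq; last by split.
    by split=> //; exists e.
  apply: bigcup_finite => [|aq [/(pl_dom pM)[_ _ _ cc] _]].
    apply: (finite_disjoint_meeting (F := fun aq => pr_edge_set aq.2)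
      (finite_out setT cX)).
      by apply: sub_trivIset (pl_disj pM) => aq [].
    by move=> aq [/(pl_dom pM)[_ _ _ /(_ X cX)[_ h]] /h].
  by case: (cc X cX).
(* The token takes the place of [a] among the unlinked vertices, so no count changes. *)
have feas : token_feasible B (~` used M) D a.
  move=> X cX; apply: leq_trans (pl_feas pM cX).
  case: (pselect (X a)) => Xa.
    rewrite asboolT // -[nat_of_bool true]/1 -(ncard_set1 a) -[leqRHS]addn0.
    rewrite -(ncard0 (vertex G)); apply: ncard_leD => //; first exact: fUX.
      by move=> v [[[? _] ?]|->]; left.
    by move=> v [[[_ nva] _] va].
  rewrite asboolF // addn0; apply: ncard_le; first exact: fUX.
  by move=> v [[? _] ?].
have [q [qa qB qH qc qfeas]] := extend_linkage fD fH feas.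
have Mq e i : M i -> pr_edge_set i.2 e -> ~ pr_edge_set q e.
  by move=> Mi ie /qH; apply; exists i.
exists q; split.
- by move=> aq [/(pl_dom pM) //|->].
- move=> i j [Mi|->] [Mj|->] // [e /= [ie je]].
  + by apply: (pl_disj pM) => //; exists e.
  + by case: (Mq e i).
  + by case: (Mq e j).
- move=> b r r' [Mr|[eb er]] [Mr'|[eb' er']].
  + exact: pl_fun pM _ _ _ Mr Mr'.
  + by case: (nMa r); rewrite -eb'.
  + by case: (nMa r'); rewrite -eb.
  + by rewrite er er'.
move=> X cX; apply: leq_trans (leq_trans (qfeas X cX) _).
  apply: ncard_le; first exact: fD.
  move=> v [[Av nv] Xv]; split=> //; split.
    by split=> // r Mr; apply: (nv r); left.
  by move=> va; apply: (nv q); right; rewrite va.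
apply: ncard_le; first exact: finite_out cX.
by apply: out_sub => e [nMe nqe] [aq [Maq ae|-> //]]; apply: nMe; exists aq.
Qed.

Lemma hall_domination_linkage A B : hall A B ->
  exists Q : vertex G -> path_or_ray G, domination_linkage A B Q.
Proof.
move=> hA.
have [C CP totC|M [pM maxM]] := @Zorn_bigcup _ (partial_linkage A B).
  exact: partial_linkage_bigcup.
have MA a : A a -> exists q, M (a, q).
  move=> Aa; apply: contrapT => nq.
  have [|q pMq] := partial_linkage_extend (a := a) hA pM.
    by split=> // q Mq; apply: nq; exists q.
  apply: maxM pMq; split; first by move=> ? ?; left.
  by move=> /(_ (a, q) (or_intror erefl)) Mq; apply: nq; exists q.
have /choice[Q QM] : forall a, exists q, A a -> M (a, q).
  move=> a; case: (pselect (A a)) => [/MA[q]|nAa]; first by exists q.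
  by have [p _] := @walk_dpath G a [::] I; exists (inl p).
exists Q; split; first by move=> a /QM /(pl_dom pM)[].
by move=> a b /QM Ma /QM Mb ab; have [] := pl_disj pM Ma Mb ab.
Qed.

End Linkage.

Theorem theorem4p1 (G : digraph) (A B : set (vertex G)) :
  (exists Q : vertex G -> path_or_ray G, domination_linkage A B Q) <->
  (forall S : set (vertex G), finite_set S -> S `<=` A -> can_be_linked S B).
Proof.
split=> [[Q [QA tQ]] S fS SA|link].
  apply: hall_linked => //; apply: (@linkage_hall _ _ _ Q).
  by split; [move=> a /SA /QA|apply: sub_trivIset tQ].
apply: hall_domination_linkage => X s cX us sAX.
(* Each instance of the Hall condition involves only a finite subset of [A], and that subset is
   linked. *)
have : hall [set` s] B by apply/linked_hall/link => // v /sAX[].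
by apply=> // v vs; split=> //; case: (sAX v vs).
Qed.
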